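(* Let $G$ and $H$ be two finite simple undirected graphs, and let $G\cup H$ denote their disjoint union. Then $e(G\cup H)=e(G)+e(H)$.
   Context: For a finite simple undirected graph $G$ with vertices $v_1,\dots,v_n$, the adjacency matrix $A(G)$ has $(i,j)$ entry $1$ if $v_i,v_j$ are adjacent and $0$ otherwise. The energy $\mathscr{E}(G)$ is the sum of the absolute values of the eigenvalues of $A(G)$ (counted with multiplicity); the graph with no vertices has energy $0$. For a vertex $v$ of $G$, let $G^{v}$ be the graph obtained from $G$ by deleting $v$. The local energy of $G$ at $v$ is $\mathscr{E}_G(v)=\mathscr{E}(G)-\mathscr{E}(G^{v})$, and the local energy of $G$ is $e(G)=\sum_{v\in V(G)}\mathscr{E}_G(v)$. In particular $e(K_1)=0$ for a single isolated vertex $K_1$. *)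

(* Defs.v *)
From HB Require Import structures.
From mathcomp Require Import all_boot all_order all_algebra.

Set Implicit Arguments.
Unset Strict Implicit.
Unset Printing Implicit Defensive.

Import Order.TTheory GRing.Theory Num.Theory.
Local Open Scope ring_scope.

(* The vertex type may be empty. *)
Record sgraph := SGraph {
  vertex :> finType;
  adj : rel vertex;
  adj_sym : symmetric adj;
  adj_irrefl : irreflexive adj
}.

Section DeleteVertex.
Variables (G : sgraph) (v : G).

Definition del_vertex_adj : rel {x : G | x != v} :=
  fun x y => adj (val x) (val y).

Fact del_vertex_sym : symmetric del_vertex_adj.
Proof. by move=> x y; apply: adj_sym. Qed.

Fact del_vertex_irrefl : irreflexive del_vertex_adj.
Proof. by move=> x; apply: adj_irrefl. Qed.

Definition del_vertex : sgraph := SGraph del_vertex_sym del_vertex_irrefl.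
End DeleteVertex.

Section DisjointUnion.
Variables G H : sgraph.

Definition disjoint_union_adj : rel (G + H)%type := fun x y =>
  match x, y with
  | inl a, inl b => adj a b
  | inr a, inr b => adj a b
  | _, _ => false
  end.

Fact disjoint_union_sym : symmetric disjoint_union_adj.
Proof. by move=> [a|a] [b|b] //=; apply: adj_sym. Qed.

Fact disjoint_union_irrefl : irreflexive disjoint_union_adj.
Proof. by move=> [a|a] /=; apply: adj_irrefl. Qed.

Definition disjoint_union : sgraph :=
  SGraph disjoint_union_sym disjoint_union_irrefl.
End DisjointUnion.

(* Vertices are numbered by [enum_val], so that v_1, ..., v_n is the          *)
(* canonical enumeration of the vertex type.                                  *)
Definition adjacency (R : nzRingType) (G : sgraph) : 'M[R]_#|G| :=
  \matrix_(i, j) (adj (enum_val i) (enum_val j))%:R.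

(* The roots of the characteristic polynomial, each repeated according to its *)
(* multiplicity.  C may be the field of complex numbers R[i] over any real    *)
(* closed R, or algC; the eigenvalues of a real symmetric matrix are real,    *)
(* and `|_| is then the usual absolute value.                                 *)
Definition eigenvalues (C : numClosedFieldType) n (A : 'M[C]_n) : seq C :=
  sval (closed_field_poly_normal (char_poly A)).

Definition energy (C : numClosedFieldType) (G : sgraph) : C :=
  \sum_(z <- eigenvalues (adjacency C G)) `|z|.

Definition vertex_energy (C : numClosedFieldType) (G : sgraph) (v : G) : C :=
  energy C G - energy C (del_vertex v).

Definition local_energy (C : numClosedFieldType) (G : sgraph) : C :=
  \sum_(v : G) vertex_energy C v.

(* Main.v *)
Require Import Defs.
From mathcomp Require Import all_boot all_order all_algebra.
From mathcomp Require Import perm.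
Import GRing.Theory Num.Theory.
Local Open Scope ring_scope.

(** The point is that the energy itself is additive on disjoint unions: listing
    the vertices of G before those of H makes the adjacency matrix of the union
    block diagonal, so its characteristic polynomial is the product of the two
    characteristic polynomials and its spectrum is the union, with
    multiplicities, of the two spectra ([energy_disjoint_union]).  Deleting a
    vertex v of G from the union leaves the union of G - v and H
    ([energy_del_vertex_inl]), so the contribution of H cancels and the local
    energy of the union at v is the local energy of G at v; symmetrically for
    the vertices of H.  Summing over all vertices concludes.

    Changing the order in which the vertices are listed is harmless because it
    conjugates the adjacency matrix by a permutation matrix
    ([char_poly_reindex]); the same fact shows that the energy is invariant
    under graph isomorphism ([energy_iso]). *)

(** The same permutation acts on the rows and on the columns, so its two signs
    cancel in the determinant of the characteristic matrix.  The two sizes are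
    distinct variables, although a bijection forces them to be equal, so that
    the lemma applies to enumerations of different types without casting
    matrices. *)
Lemma char_poly_reindex (R : comNzRingType) n m (A : 'M[R]_n) (B : 'M[R]_m)
    (f : 'I_n -> 'I_m) :
  bijective f -> (forall i j, A i j = B (f i) (f j)) ->
  char_poly A = char_poly B.
Proof.
move=> bij_f; have eq_nm : n = m.
  by have := bij_eq_card bij_f; rewrite !card_ord.
case: _ / eq_nm in B f bij_f * => AB.
pose s := perm (bij_inj bij_f).
have -> : char_poly A = \det (row_perm s (col_perm s (char_poly_mx B))).
  congr (\det _); apply/matrixP=> i j.
  by rewrite !mxE !permE AB (inj_eq (bij_inj bij_f)).
rewrite row_permE col_permE !det_mulmx !det_perm odd_permV mulrCA.
by rewrite -signr_addb addbb mulr1.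
Qed.

Lemma prod_eigenvalues (C : numClosedFieldType) n (A : 'M[C]_n) :
  \prod_(z <- eigenvalues A) ('X - z%:P) = char_poly A.
Proof.
rewrite /eigenvalues; case: closed_field_poly_normal => r /= def_p.
by rewrite [RHS]def_p (monicP (char_poly_monic A)) scale1r.
Qed.

(** [eigenvalues] fixes an arbitrary ordering of the roots, so the characteristic
    polynomial determines it only up to permutation; this is enough for sums
    such as the energy. *)
Lemma eigenvalues_perm (C : numClosedFieldType) n (A : 'M[C]_n) (s : seq C) :
  char_poly A = \prod_(z <- s) ('X - z%:P) -> perm_eq (eigenvalues A) s.
Proof. by rewrite -prod_eigenvalues; apply: prod_XsubC_eq. Qed.

Lemma energy_iso (C : numClosedFieldType) (G H : sgraph) (f : G -> H) :
  bijective f -> (forall x y, adj (f x) (f y) = adj x y) ->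
  energy C G = energy C H.
Proof.
move=> bij_f adj_f; apply/perm_big/eigenvalues_perm; rewrite prod_eigenvalues.
apply: (@char_poly_reindex _ _ _ _ _ (fun i => enum_rank (f (enum_val i)))).
  by apply: bij_comp (bij_comp bij_f _); [apply: enum_rank_bij
                                         |apply: enum_val_bij].
by move=> i j; rewrite !mxE !enum_rankK adj_f.
Qed.

(** There are no edges between the two parts, so the off-diagonal blocks of the
    adjacency matrix vanish and the determinant factors. *)
Lemma char_poly_disjoint_union (R : comNzRingType) (G H : sgraph) :
  char_poly (adjacency R (disjoint_union G H)) =
  char_poly (adjacency R G) * char_poly (adjacency R H).
Proof.
rewrite -[RHS](det_ublock _ 0) -char_block_diag_mx; apply/esym.
(* The vertices of G are listed first, then those of H. *)
pose vert (i : 'I_(#|G| + #|H|)) : disjoint_union G H :=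
  match split i with
  | inl a => inl (enum_val a)
  | inr b => inr (enum_val b)
  end.
pose rank (x : disjoint_union G H) : 'I_(#|G| + #|H|) :=
  match x with
  | inl a => lshift _ (enum_rank a)
  | inr b => rshift _ (enum_rank b)
  end.
have vertK : cancel vert rank.
  by move=> i; rewrite /vert; case: split_ordP => k -> /=; rewrite enum_valK.
have rankK : cancel rank vert.
  by case=> x; rewrite /vert /rank;
    [rewrite (unsplitK (inl _))|rewrite (unsplitK (inr _))]; rewrite enum_rankK.
apply: (@char_poly_reindex _ _ _ _ _ (fun i => enum_rank (vert i))).
  by apply: bij_comp (enum_rank_bij _) _; exists rank.
move=> i j; rewrite -(vertK i) -(vertK j) !rankK [RHS]mxE !enum_rankK.
by case: (vert i) (vert j) => [a|a] [b|b] /=;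
  rewrite ?block_mxEul ?block_mxEur ?block_mxEdl ?block_mxEdr mxE ?enum_rankK.
Qed.

Lemma energy_disjoint_union (C : numClosedFieldType) (G H : sgraph) :
  energy C (disjoint_union G H) = energy C G + energy C H.
Proof.
rewrite /energy -big_cat; apply/perm_big/eigenvalues_perm.
by rewrite char_poly_disjoint_union big_cat !prod_eigenvalues.
Qed.

(** The graph (G + H) - v is isomorphic to (G - v) + H but its vertex type is a
    subtype of a sum rather than a sum of a subtype, so an explicit isomorphism
    is needed; it is onto because both sides have #|G| + #|H| - 1 vertices. *)
Lemma energy_del_vertex_inl (C : numClosedFieldType) (G H : sgraph) (v : G) :
  energy C (@del_vertex (disjoint_union G H) (inl v)) =
  energy C (del_vertex v) + energy C H.
Proof.
rewrite -energy_disjoint_union; apply/esym.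
pose f (x : disjoint_union (del_vertex v) H) :
    @del_vertex (disjoint_union G H) (inl v) :=
  match x with
  | inl a => exist _ (inl (val a)) (valP a)
  | inr b => exist _ (inr b) isT
  end.
apply: (@energy_iso C _ _ f); last by case=> [a|a] [b|b].
apply: inj_card_bij => [[a|a] [b|b] /(congr1 val) //= [] | ].
- by move/val_inj->.
- by move->.
rewrite card_sum !card_sig !cardC1 card_sum.
by have /prednK<- : (0 < #|G|)%N by apply/card_gt0P; exists v.
Qed.

Lemma energy_del_vertex_inr (C : numClosedFieldType) (G H : sgraph) (w : H) :
  energy C (@del_vertex (disjoint_union G H) (inr w)) =
  energy C G + energy C (del_vertex w).
Proof.
rewrite -energy_disjoint_union; apply/esym.
pose f (x : disjoint_union G (del_vertex w)) :
    @del_vertex (disjoint_union G H) (inr w) :=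
  match x with
  | inl a => exist _ (inl a) isT
  | inr b => exist _ (inr (val b)) (valP b)
  end.
apply: (@energy_iso C _ _ f); last by case=> [a|a] [b|b].
apply: inj_card_bij => [[a|a] [b|b] /(congr1 val) //= [] | ].
- by move->.
- by move/val_inj->.
rewrite card_sum !card_sig !cardC1 card_sum.
have /prednK<- : (0 < #|H|)%N by apply/card_gt0P; exists w.
by rewrite addnS.
Qed.

Theorem theorem1 (C : numClosedFieldType) (G H : sgraph) :
  local_energy C (disjoint_union G H) = local_energy C G + local_energy C H.
Proof.
rewrite /local_energy big_sumType /=; congr (_ + _); apply: eq_bigr => v _.
  rewrite /vertex_energy energy_del_vertex_inl energy_disjoint_union.
  by rewrite opprD addrACA subrr addr0.
rewrite /vertex_energy energy_del_vertex_inr energy_disjoint_union.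
by rewrite opprD addrACA subrr add0r.
Qed.
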